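(* Let $\lambda$ be an eigenvalue of the matrix $B$ with elementary divisor of multiplicity $m$ ($m\ge2$) corresponding to the real eigenvector $\nu^0$ and to the real generalized eigenvector $\nu^1$ of order $1$. Then the system $\dfrac{dx}{dt}=Ax$ has the autonomous first integral $$F\colon x\to\nu^0x\,\exp\Bigl(-\lambda\,\frac{\nu^1x}{\nu^0x}\Bigr)\quad\text{for all }x\in\mathscr X,$$ where $\mathscr X\subset\{x\colon\nu^0x\ne0\}$ is a domain.
   Context: $A$ is a real $n\times n$ matrix, $x\in\mathbb R^n$, and $B=A^T$. For a vector $\nu$, $\nu x=\sum_{i=1}^n\nu_ix_i$. If $\nu^0$ is an eigenvector of $B$ for the eigenvalue $\lambda$ with elementary divisor of multiplicity $m$, a nonzero vector $\nu^k$ is a generalized eigenvector of order $k$ for $\lambda$ if $(B-\lambda E)\nu^k=k\,\nu^{k-1}$, $k=1,\ldots,m-1$ ($E$ the identity matrix). A continuously differentiable function $F$ on a domain $\mathscr X\subset\mathbb R^n$ is an autonomous first integral of $dx/dt=Ax$ if $\sum_{i=1}^n(Ax)_i\,\partial_{x_i}F(x)=0$ on $\mathscr X$. *)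

(* Defs.v *)
From HB Require Import structures.
From mathcomp Require Import all_boot all_order all_algebra.
From mathcomp Require Import all_classical all_reals all_analysis.
Set Implicit Arguments.
Unset Strict Implicit.
Unset Printing Implicit Defensive.
Import Order.TTheory GRing.Theory Num.Theory.
Import numFieldNormedType.Exports.

Local Open Scope classical_set_scope.
Local Open Scope ring_scope.

Definition pairing (R : realType) (n : nat) (nu x : 'cV[R]_n) : R :=
  \sum_(i < n) nu i 0 * x i 0.

(* Gcd of the k x k minors of XE - B. Repeated rows or columns contribute 0 and
   reorderings only change signs, so f and g need not be increasing.
   The gcd is only determined up to a nonzero constant factor. *)
Definition determinantal_divisor (R : realType) (n : nat) (B : 'M[R]_n)
    (k : nat) : {poly R} :=
  \big[@gcdp R/0]_(f : {ffun 'I_k -> 'I_n}) \big[@gcdp R/0]_(g : {ffun 'I_k -> 'I_n})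
    \det (mxsub f g (char_poly_mx B)).

Definition invariant_factor (R : realType) (n : nat) (B : 'M[R]_n) (k : nat) :
    {poly R} :=
  determinantal_divisor B k.+1 %/ determinantal_divisor B k.

(* (X - lam)^m is an elementary divisor of B: it is the exact power of X - lam
   in one of the n invariant factors of B. *)
Definition elementary_divisor (R : realType) (n : nat) (B : 'M[R]_n) (lam : R)
    (m : nat) : Prop :=
  (0 < m)%N /\ exists k : 'I_n, mup lam (invariant_factor B k) = m.

(* Column eigenvectors; mathcomp's [eigenvalue] and [eigenspace] use rows. *)
Definition eigenvector (R : realType) (n : nat) (B : 'M[R]_n) (lam : R)
    (v : 'cV[R]_n) : Prop :=
  v != 0 /\ B *m v = lam *: v.

(* v has order k and w is its predecessor, of order k - 1. *)
Definition generalized_eigenvector (R : realType) (n : nat) (B : 'M[R]_n)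
    (lam : R) (k : nat) (w v : 'cV[R]_n) : Prop :=
  v != 0 /\ (B - lam%:M) *m v = k%:R *: w.

Definition jordan_chain (R : realType) (n : nat) (B : 'M[R]_n) (lam : R)
    (p : nat) (nu : nat -> 'cV[R]_n) : Prop :=
  eigenvector B lam (nu 0%N) /\
  forall k : nat, (0 < k < p)%N ->
    generalized_eigenvector B lam k (nu k.-1) (nu k).

(* v is an eigenvector corresponding to the elementary divisor (X - lam)^m:
   the longest chains of generalized eigenvectors starting at v are
   nu^0 = v, ..., nu^(m-1). *)
Definition eigenvector_of_elementary_divisor (R : realType) (n : nat)
    (B : 'M[R]_n) (lam : R) (m : nat) (v : 'cV[R]_n) : Prop :=
  [/\ elementary_divisor B lam m,
      eigenvector B lam v,
      exists nu : nat -> 'cV[R]_n, nu 0%N = v /\ jordan_chain B lam m nu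
    & forall (p : nat) (nu : nat -> 'cV[R]_n),
        nu 0%N = v -> jordan_chain B lam p nu -> (p <= m)%N].

Definition domain (R : realType) (n : nat) (X : set 'cV[R]_n) : Prop :=
  [/\ X !=set0, open X & connected X].

Definition partial (R : realType) (n : nat) (i : 'I_n) (F : 'cV[R]_n -> R)
    (x : 'cV[R]_n) : R :=
  'D_(delta_mx i 0) F x.

Definition continuously_differentiable_on (R : realType) (n : nat)
    (X : set 'cV[R]_n) (F : 'cV[R]_n -> R) : Prop :=
  forall x : 'cV[R]_n, X x -> forall i : 'I_n,
    derivable F x (delta_mx i 0) /\ {for x, continuous (partial i F)}.

(* Only the values of F on the open set X matter. *)
Definition autonomous_first_integral (R : realType) (n : nat) (A : 'M[R]_n)
    (X : set 'cV[R]_n) (F : 'cV[R]_n -> R) : Prop :=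
  continuously_differentiable_on X F /\
  forall x : 'cV[R]_n, X x -> \sum_(i < n) (A *m x) i 0 * partial i F x = 0.

(* Main.v *)
Require Import Defs.
From HB Require Import structures.
From mathcomp Require Import all_boot all_order all_algebra.
From mathcomp Require Import all_classical all_reals all_analysis.
From mathcomp Require Import ring.
Import Order.TTheory GRing.Theory Num.Theory.
Import numFieldNormedType.Exports.
Local Open Scope classical_set_scope.
Local Open Scope ring_scope.

(** Along a solution of [dx/dt = A x], the linear form [p0 = pairing nu0]
    satisfies [p0' = lam p0], because [nu0] is an eigenvector of [A^T], and
    [p1 = pairing nu1] satisfies [p1' = lam p1 + p0], because [nu1] is a
    generalized eigenvector of order 1 above [nu0].  Hence [(p1 / p0)' = 1]:
    the quotient measures time, while [p0] grows like [exp (lam t)].  So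
    [F = p0 * exp (- lam * (p1 / p0))] is constant along the flow.

    The statement is about partial derivatives rather than solutions, so the
    same computation is done on differentials: the derivative of [F] at [x] in
    the direction [v] is the explicit expression [dexp_integral lam nu0 nu1 x v]
    ([is_derive_exp_integral]), which is linear in [v], continuous in [x] where
    [p0 x != 0] ([continuous_dexp_integral]), and zero for [v = A x]
    ([dexp_integral_flow]).  Its linearity in [v] turns the sum of the
    [(A x)_i] times the partial derivatives into the value at [v = A x]. *)

(** A directional derivative is the ordinary derivative at 0 of the restriction
    to the line through [x]; this reduces everything to functions of one real
    variable, where the chain rule for [expR] and the rule for inverses apply. *)
Lemma is_derive_line (R : realType) (V : normedModType R) (F : V -> R)
    (x v : V) (dF : R) :
  is_derive (0 : R) 1 (fun h : R => F (h *: v + x)) dF -> is_derive x v F dF.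
Proof.
move=> dFline.
split; first exact/derivable1P/(@ex_derive _ _ _ _ _ _ _ dFline).
have <- : 'D_1 (fun h : R => F (h *: v + x)) 0 = dF.
  exact: (@derive_val _ _ _ _ _ _ _ dFline).
rewrite /derive; set g1 := fun h => h^-1 *: _; set g2 := fun h => h^-1 *: _.
suff -> : g1 = g2 by [].
by rewrite funeqE /g1 /g2 => h /=; rewrite addr0 scale0r add0r [_%:A]mulr1.
Qed.

Lemma is_derive_affine {R : realType} (u w x : R) :
  is_derive x 1 (fun h : R => h * u + w) u.
Proof.
have -> : (fun h : R => h * u + w) = u \*: id + cst w.
  by apply/funext => h; rewrite fctE mulrC.
by apply: is_derive_eq; rewrite addr0 [_%:A]mulr1.
Qed.

Section Pairing.
Context {R : realType} {n : nat}.
Implicit Types (nu x v : 'cV[R]_n) (A : 'M[R]_n).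

Lemma pairing_line nu v x (h : R) :
  pairing nu (h *: v + x) = h * pairing nu v + pairing nu x.
Proof.
rewrite /pairing mulr_sumr -big_split /=; apply: eq_bigr => i _.
by rewrite !mxE; ring.
Qed.

Lemma pairing_delta nu (i : 'I_n) : pairing nu (delta_mx i 0) = nu i 0.
Proof.
rewrite /pairing (bigD1 i) //= big1 ?addr0 => [|j /negPf ji].
  by rewrite mxE !eqxx mulr1.
by rewrite mxE ji mulr0.
Qed.

Lemma pairing_mxE nu x : pairing nu x = (nu^T *m x) 0 0.
Proof. by rewrite mxE; apply: eq_bigr => i _; rewrite mxE. Qed.

Lemma pairing_trmx nu A x : pairing nu (A *m x) = pairing (A^T *m nu) x.
Proof. by rewrite !pairing_mxE trmx_mul trmxK mulmxA. Qed.

Lemma continuous_pairing nu : continuous (pairing nu).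
Proof.
have cont_term (i : 'I_n) : continuous (fun x : 'cV[R]_n => nu i 0 * x i 0).
  by move=> x; apply: continuousM; [exact: cst_continuous | exact: coord_continuous].
apply: continuous_big => [|i _]; [exact: add_continuous | exact: cont_term].
Qed.

End Pairing.

Section PairingFlow.
Context {R : realType} {n : nat} {A : 'M[R]_n} {lam : R} {nu0 : 'cV[R]_n}.

Lemma pairing_eigenvector (x : 'cV[R]_n) : eigenvector A^T lam nu0 ->
  pairing nu0 (A *m x) = lam * pairing nu0 x.
Proof.
move=> [_ Anu0].
by rewrite pairing_trmx Anu0 !pairing_mxE linearZ -scalemxAl mxE.
Qed.

Lemma pairing_generalized_eigenvector1 (nu1 x : 'cV[R]_n) :
  generalized_eigenvector A^T lam 1 nu0 nu1 ->
  pairing nu1 (A *m x) = lam * pairing nu1 x + pairing nu0 x.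
Proof.
move=> [_]; rewrite scale1r mulmxBl mul_scalar_mx => /eqP.
rewrite subr_eq addrC => /eqP Anu1.
by rewrite pairing_trmx Anu1 !pairing_mxE linearD linearZ mulmxDl -scalemxAl !mxE.
Qed.

End PairingFlow.

Section ExpIntegral.
Context {R : realType} {n : nat} (lam : R) (nu0 nu1 : 'cV[R]_n).
Implicit Types x v : 'cV[R]_n.

Definition exp_integral x : R :=
  pairing nu0 x * expR (- lam * (pairing nu1 x / pairing nu0 x)).

(** The differential of [exp_integral] at [x], applied to [v]: the factor
    multiplying [lam] is [p0 x] times the differential of [p1 / p0]. *)
Definition dexp_integral x v : R :=
  expR (- lam * (pairing nu1 x / pairing nu0 x)) *
  (pairing nu0 v -
   lam * (pairing nu1 v - pairing nu1 x / pairing nu0 x * pairing nu0 v)).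

Lemma is_derive_exp_integral x v : pairing nu0 x != 0 ->
  is_derive x v exp_integral (dexp_integral x v).
Proof.
rewrite /dexp_integral => p0.
apply: is_derive_line; rewrite /exp_integral.
under eq_fun do rewrite !pairing_line.
move: (pairing nu0 x) (pairing nu1 x) (pairing nu0 v) (pairing nu1 v) p0.
move=> b d a c b0.
have db := is_derive_affine a b 0; have dd := is_derive_affine c d 0.
have nz : 0 * a + b != 0 by rewrite mul0r add0r.
have dV := @is_deriveV R (fun h : R => h * a + b) 0 _ 1 nz db.
have de := is_derive1_comp (is_derive_expR _)
  (is_deriveZ (- lam) (is_deriveM dd dV)).
apply: is_derive_eq (is_deriveM db de) _ => /=.
rewrite /GRing.scale /= !fctE !mul0r !add0r.
by field.
Qed.

Lemma continuous_dexp_integral v x : pairing nu0 x != 0 ->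
  {for x, continuous (dexp_integral^~ v)}.
Proof.
move=> p0.
have cq : {for x, continuous (fun y => pairing nu1 y / pairing nu0 y)}.
  apply: continuousM; first exact: continuous_pairing.
  by apply: continuousV => //; exact: continuous_pairing.
rewrite /dexp_integral; apply: continuousM.
  apply: (continuous_comp (g := expR)); last exact: continuous_expR.
  by apply: continuousM => //; exact: cst_continuous.
apply: continuousB; first exact: cst_continuous.
apply: continuousM; first exact: cst_continuous.
apply: continuousB; first exact: cst_continuous.
by apply: continuousM => //; exact: cst_continuous.
Qed.

Lemma sum_dexp_integral_delta x v :
  \sum_(i < n) v i 0 * dexp_integral x (delta_mx i 0) = dexp_integral x v.
Proof.
rewrite /dexp_integral.
under eq_bigr do rewrite !pairing_delta.
set E := expR _; set q := _ / _.
rewrite /pairing [q * _]mulr_sumr -sumrB mulr_sumr -sumrB mulr_sumr.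
by apply: eq_bigr => i _; ring.
Qed.

Lemma dexp_integral_flow (A : 'M[R]_n) x :
    eigenvector A^T lam nu0 -> generalized_eigenvector A^T lam 1 nu0 nu1 ->
    pairing nu0 x != 0 ->
  dexp_integral x (A *m x) = 0.
Proof.
move=> hnu0 hnu1 p0; rewrite /dexp_integral.
rewrite (pairing_eigenvector _ hnu0) (pairing_generalized_eigenvector1 _ _ hnu1).
by field.
Qed.

End ExpIntegral.

Theorem theorem3p6 (R : realType) (n : nat) (A : 'M[R]_n) (lam : R) (m : nat)
    (nu0 nu1 : 'cV[R]_n) (X : set 'cV[R]_n)
    (hm : (2 <= m)%N)
    (hnu0 : eigenvector_of_elementary_divisor A^T lam m nu0)
    (hnu1 : generalized_eigenvector A^T lam 1 nu0 nu1)
    (hX : domain X)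
    (hX0 : X `<=` [set x : 'cV[R]_n | pairing nu0 x != 0]) :
  autonomous_first_integral A X
    (fun x : 'cV[R]_n =>
       pairing nu0 x * expR (- lam * (pairing nu1 x / pairing nu0 x))).
Proof.
rewrite -/(exp_integral lam nu0 nu1).
have [_ nu0_eig _ _] := hnu0; have [_ X_open _] := hX.
have dF x v (Xx : X x) := is_derive_exp_integral lam nu0 nu1 x v (hX0 x Xx).
have partialE i x : X x -> partial i (exp_integral lam nu0 nu1) x =
    dexp_integral lam nu0 nu1 x (delta_mx i 0).
  by move=> Xx; exact: (@derive_val _ _ _ _ _ _ _ (dF x _ Xx)).
split=> [x Xx i|x Xx].
  split; first exact: (@ex_derive _ _ _ _ _ _ _ (dF x _ Xx)).
  (* Continuity at x needs the formula for the partial derivative at all points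
     near x; this is where X being open enters. *)
  have nearE : \forall y \near x, dexp_integral lam nu0 nu1 y (delta_mx i 0) =
      partial i (exp_integral lam nu0 nu1) y.
    apply: filterS (open_nbhs_nbhs (conj X_open Xx)) => y Xy.
    by rewrite partialE.
  apply: cvg_trans (near_eq_cvg nearE) _.
  by rewrite partialE //; apply: continuous_dexp_integral; exact: hX0.
under eq_bigr do rewrite partialE //.
by rewrite sum_dexp_integral_delta dexp_integral_flow //; exact: hX0.
Qed.
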